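(* Let $G$ be a $7$-tough $(P_4\cup P_1)$-free graph on $n$ vertices, and put $a=n/8$. Let $X$ be a cutset of $G$. Suppose that $G-X$ has a component $D$ such that either \[ |D|>2a-2\quad\text{and}\quad \sum_{D'\ne D}|D'|>a-1, \] or \[ |D|>a-1\quad\text{and}\quad \sum_{D'\ne D}|D'|>2a-2, \] where the sums range over the components $D'$ of $G-X$ other than $D$. Then $G$ is Hamiltonian.
   Context: All graphs are finite and simple. A graph is Hamiltonian if it contains a spanning cycle. $P_4\cup P_1$ denotes the disjoint union of a path on four vertices and a single isolated vertex; a graph is $H$-free if it contains no induced subgraph isomorphic to $H$. For a graph $G$ and $X\subseteq V(G)$, $c(G-X)$ denotes the number of connected components of $G-X$. The toughness of $G$ is $\tau(G)=\min\{|X|/c(G-X): X\subseteq V(G),\ c(G-X)\ge 2\}$, with $\tau(G)=\infty$ if $G$ is complete; $G$ is $t$-tough if $\tau(G)\ge t$. A set $X\subseteq V(G)$ is a cutset of $G$ if $c(G-X)\ge2$. For a component $D$, $|D|$ denotes its number of vertices. *)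

(* Defs.v *)
From HB Require Import structures.
From mathcomp Require Import all_boot all_order all_algebra.
From mathcomp Require Import constructive_ereal.

Set Implicit Arguments.
Unset Strict Implicit.
Unset Printing Implicit Defensive.

Import Order.TTheory GRing.Theory Num.Theory.

Local Open Scope ring_scope.

(* A finite simple graph is a symmetric irreflexive relation on a finite type. *)
Section Graph.

Variables (T : finType) (e : rel T).

Definition complete : bool := [forall x, forall y, (x != y) ==> e x y].

(* Adjacency in G - X, kept as a relation on T: the vertices of X become
   isolated, and [components] partitions only the complement of X. *)
Definition del_rel (X : {set T}) : rel T :=
  [rel x y | [&& x \notin X, y \notin X & e x y]].

Definition components (X : {set T}) : {set {set T}} :=
  equivalence_partition (connect (del_rel X)) (~: X).

Definition num_components (X : {set T}) : nat := #|components X|.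

Definition cutset (X : {set T}) : bool := (2 <= num_components X)%N.

Definition toughness : \bar rat :=
  if complete then +oo%E
  else \big[Order.min/+oo%E]_(X : {set T} | cutset X)
         (#|X|%:R / (num_components X)%:R)%:E.

Definition tough (t : rat) : bool := (t%:E <= toughness)%E.

(* The size condition excludes the degenerate closed walks of length at most 2
   that [ucycle] accepts. *)
Definition hamiltonian : Prop :=
  exists s : seq T, [/\ ucycle e s, (2 < size s)%N & forall x, x \in s].

End Graph.

Definition induced_subgraph (H T : finType) (h : rel H) (e : rel T) : Prop :=
  exists f : H -> T, injective f /\ forall x y, e (f x) (f y) = h x y.

Definition is_free (H T : finType) (h : rel H) (e : rel T) : Prop :=
  ~ induced_subgraph h e.

Definition path_graph (n : nat) : rel 'I_n :=
  [rel i j : 'I_n | (i.+1 == j :> nat) || (j.+1 == i :> nat)].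
Arguments path_graph : clear implicits.

Definition disjoint_union (T1 T2 : finType) (e1 : rel T1) (e2 : rel T2) :
    rel (T1 + T2)%type :=
  fun u v => match u, v with
             | inl x, inl y => e1 x y
             | inr x, inr y => e2 x y
             | _, _ => false
             end.

(* Main.v *)
(* Let C be a longest cycle, H a component of G - C and A its neighbourhood. A
   path from a^+ to b^+ (successors on C of a, b in A) through C and H has more vertices than C, so
   its ends are nonadjacent, every common neighbour of the ends lies on it, and no
   two consecutive vertices of it are both adjacent to both ends. Outside A and H
   the graph is P4-free, because H supplies an isolated fifth vertex; by Seinsche
   a component W holding both ends y1, y2 of such a path is a join, and deleting
   the part of W that is complete to the co-component of y1 splits W. Let J be the
   set of all vertices deleted in this way. First split until the successors a^+
   are separated. If afterwards u1, u2 in J are followed on C by two vertices w1,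
   w2 of one component, and its path traverses both arcs (u_i, w_i) in the same
   direction, two rotations turn that path into one from w1 to w2, losing only
   these two arcs, and the component splits further. When this stops, c components
   remain, with |A| <= c and |J| <= 4c, against 7c <= |A| + |J|. *)
Require Import Defs.
From mathcomp Require Import all_boot all_order all_algebra.
From mathcomp Require Import constructive_ereal zify.

Set Implicit Arguments.
Unset Strict Implicit.
Unset Printing Implicit Defensive.

(** * P4-free graphs *)

Section Connectivity.

Variable T : finType.
Implicit Types (g r : rel T) (B : {set T}).

Lemma connect_exit r (P : pred T) x y :
  connect r x y -> P x -> ~~ P y ->
  exists u v, [/\ connect r x u, P u, r u v & ~~ P v].
Proof.
move=> /connectP[p]; elim: p x => [|z p IHp] x /=.
  by move=> _ -> -> .
case/andP=> rxz pp yE Px Py; case Pz: (P z); last by exists x, z; rewrite Pz.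
have [u [v [zu Pu ruv Pv]]] := IHp z pp yE Pz Py.
by exists u, v; split=> //; apply: connect_trans zu; apply: connect1.
Qed.

Lemma connect_inv r (P : pred T) x y :
  (forall u v, P u -> r u v -> P v) -> connect r x y -> P x -> P y.
Proof.
move=> rP xy Px; case Py: (P y) => //.
have [u [v [_ Pu ruv]]] := connect_exit xy Px (negbT Py).
by rewrite (rP u v).
Qed.

Definition restrict B g : rel T := [rel x y | [&& x \in B, y \in B & g x y]].

Definition co_rel g : rel T := [rel x y | (x != y) && ~~ g x y].

(** For a symmetric irreflexive [g], the listed adjacencies and non-adjacencies force the four
    vertices to be distinct. *)
Definition P4_free_on B g := forall a b c d,
  a \in B -> b \in B -> c \in B -> d \in B ->
  g a b -> g b c -> g c d -> ~~ g a c -> ~~ g a d -> ~~ g b d -> False.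

Lemma co_rel_sym g : symmetric g -> symmetric (co_rel g).
Proof. by move=> gS x y; rewrite /co_rel /= eq_sym gS. Qed.

Lemma co_relK g : irreflexive g -> co_rel (co_rel g) =2 g.
Proof. by move=> gI x y; rewrite /co_rel /=; have [->|_] := eqVneq x y; rewrite ?gI ?negbK. Qed.

Lemma restrict_sym B g : symmetric g -> symmetric (restrict B g).
Proof. by move=> gS x y; rewrite /restrict /= gS andbCA. Qed.

Lemma connect_restrict_mem B g x y :
  connect (restrict B g) x y -> x \in B -> y \in B.
Proof. by apply: connect_inv => u v _ /and3P[]. Qed.

(* P4 is self-complementary. *)
Lemma P4_free_on_co B g :
  symmetric g -> P4_free_on B g -> P4_free_on B (co_rel g).
Proof.
move=> gS gF a b c d aB bB cB dB; rewrite /co_rel /= => /andP[ab gab].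
move=> /andP[bc gbc] /andP[cd gcd].
rewrite !negb_and !negbK.
case: eqP => [ac|_ /= gac]; first by rewrite -ac in cd gcd; rewrite (negbTE cd) (negbTE gcd).
case: eqP => [ad|_ /= gad]; first by rewrite -ad gS gac in gcd.
case: eqP => [bd|_ /= gbd]; first by rewrite bd gad in gab.
(* The complement of the path [a b c d] is the path [b d a c]. *)
by apply: (gF b d a c); rewrite // 1?gS // gS.
Qed.

(** Suppose [B :\ v] is disconnected. As the complement is connected, some [w] is not adjacent to
    [v]; as [B] is connected, the component of [w] contains a neighbour of [v], hence an edge from a
    non-neighbour [q] to a neighbour [q'] of [v]. If [z] is a neighbour of [v] in another component,
    then [z v q' q] is an induced path. *)
Lemma P4_free_step B g v :
  symmetric g -> P4_free_on B g -> v \in B ->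
  {in B &, forall x y, connect (restrict B g) x y} ->
  {in B &, forall x y, connect (restrict B (co_rel g)) x y} ->
  {in B :\ v &, forall x y, connect (restrict (B :\ v) g) x y}.
Proof.
move=> gS gF vB gB coB x0 z0 x0B z0B; apply/negP => /negP nxz.
have rS := sym_connect_sym (restrict_sym (B :\ v) gS).
have [x0v x0B'] := setD1P x0B; have [z0v z0B'] := setD1P z0B.
have [v' [w [_ /eqP-> {v'}]]] := connect_exit (P := pred1 v) (coB v x0 vB x0B') (eqxx v) x0v.
move=> /and3P[_ wB /andP[_ gvw]] wv.
have wB' : w \in B :\ v by rewrite in_setD1 wv.
have nbr t : t \in B :\ v ->
  exists p, [/\ p \in B :\ v, connect (restrict (B :\ v) g) t p & g p v].
  move=> tB; have /setD1P[_ tB'] := tB.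
  have nv : ~~ connect (restrict (B :\ v) g) t v.
    by apply: contraL tB => /connect_restrict_mem H; apply/negP => /H; rewrite setD11.
  have [u [u' [_ tu /and3P[uB u'B guu'] ntu']]] :=
    connect_exit (gB t v tB' vB) (connect0 _ t) nv.
  have uB' := connect_restrict_mem tu tB.
  exists u; split=> //; have [<-//|u'v] := eqVneq u' v.
  case/negP: ntu'; apply: connect_trans tu (connect1 _).
  by apply/and3P; split=> //; rewrite in_setD1 u'v.
have [z1 z1B nwz1] : exists2 z1, z1 \in B :\ v &
    ~~ connect (restrict (B :\ v) g) w z1.
  case wx: (connect (restrict (B :\ v) g) w x0); last by exists x0; rewrite ?wx.
  exists z0 => //; apply: contra nxz => wz; apply: connect_trans wz.
  by rewrite rS.
have [p [pB wp gpv]] := nbr w wB'.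
have [z [zB z1z gzv]] := nbr z1 z1B.
have [|q [q' [wq gvq /and3P[qB q'B gqq'] /negPn gvq']]] :=
   connect_exit (P := fun t => ~~ g v t) wp gvw; first by rewrite gS gpv.
have nz t : connect (restrict (B :\ v) g) w t -> ~~ g z t.
  move=> wt; apply: contra nwz1 => gzt.
  rewrite rS; apply: (connect_trans z1z); rewrite rS; apply: (connect_trans wt).
  apply: connect1; apply/and3P; split=> //; last by rewrite gS.
  exact: connect_restrict_mem wt wB'.
have wq' : connect (restrict (B :\ v) g) w q'.
  by apply: connect_trans wq (connect1 _); apply/and3P.
apply: (gF z v q' q); rewrite ?nz // 1?gS //.
- by case/setD1P: zB.
- by case/setD1P: q'B.
- by case/setD1P: qB.
Qed.

(* Seinsche's theorem. *)
Lemma P4_free_connected B g :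
  symmetric g -> irreflexive g -> P4_free_on B g -> 1 < #|B| ->
  {in B &, forall x y, connect (restrict B g) x y} ->
  {in B &, forall x y, connect (restrict B (co_rel g)) x y} -> False.
Proof.
move: {2}#|B| (leqnn #|B|) => n; elim: n B => [|n IHn] B leBn gS gI gF B_gt1 gB coB.
  by case: #|B| leBn B_gt1.
have [v vB] : exists v, v \in B by apply/card_gt0P; apply: ltn_trans B_gt1.
have cB : #|B :\ v| = #|B|.-1 by rewrite (cardsD1 v B) vB.
(* Deleting [v] keeps both the graph and its complement connected, so the induction descends to two
   vertices. *)
have gB' := P4_free_step gS gF vB gB coB.
have coB' : {in B :\ v &, forall x y, connect (restrict (B :\ v) (co_rel g)) x y}.
  apply: P4_free_step => //; first exact: co_rel_sym; first exact: P4_free_on_co.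
  move=> x y xB yB; rewrite (@eq_connect _ _ (restrict B g)) ?gB // => s t.
  by rewrite /restrict /= -/(co_rel g s t) -[in RHS](co_relK gI).
have [B2|B2] := leqP #|B :\ v| 1; last first.
  apply: (IHn (B :\ v)) => //; first by lia.
  move=> a b c d /setD1P[_ aB] /setD1P[_ bB] /setD1P[_ cB'] /setD1P[_ dB].
  exact: gF.
(* Only [v] and one vertex [w] are left; connectivity makes them adjacent both in [g] and in its
   complement. *)
have /card_gt0P[w] : 0 < #|B :\ v| by lia.
case/setD1P=> wv wB.
have only u : u \in B -> u != v -> u = w.
  move=> uB uv; apply: (card_le1_eqP B2); by rewrite in_setD1 ?uv ?wv.
have wv' : ~~ pred1 v w by [].
have [v1 [u [_ /eqP-> /and3P[_ uB gvu] uv]]] :=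
  connect_exit (P := pred1 v) (gB v w vB wB) (eqxx v) wv'.
have [v2 [u' [_ /eqP-> /and3P[_ u'B /andP[_ gvu']] u'v]]] :=
  connect_exit (P := pred1 v) (coB v w vB wB) (eqxx v) wv'.
by move: gvu gvu'; rewrite (only u) // (only u') // => ->.
Qed.

End Connectivity.

(** * Paths longer than a longest cycle *)

Section ConsecutivePairs.

Variable T : eqType.
Implicit Types (p q r : seq T) (u v x y : T).

Fixpoint consec q u v :=
  if q is a :: q' then
    (if q' is b :: _ then (a == u) && (b == v) else false) || consec q' u v
  else false.

Lemma consecP q u v :
  reflect (exists p1 p2, q = rcons p1 u ++ v :: p2) (consec q u v).
Proof.
apply: (iffP idP) => [|[p1 [p2 ->]]]; last first.
  elim: p1 => [|a p1 IHp] /=; first by rewrite !eqxx.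
  by rewrite IHp orbT.
elim: q => [|a [|b q] IHq] //= /orP[/andP[/eqP-> /eqP->]|/IHq[p1 [p2 ->]]].
  by exists [::], q.
by exists (a :: p1), p2.
Qed.

Lemma consec_cat x0 p r u v :
  consec (p ++ r) u v = [|| consec p u v, consec r u v |
     [&& p != [::], r != [::], last x0 p == u & head x0 r == v]].
Proof.
elim: p x0 => [|a p IHp] x0; first by rewrite /= orbF.
rewrite [in LHS]/= (IHp a) {IHp}.
case: p => [|b p] /=; last by rewrite -!orbA; case: r.
by case: r => [|b r] /=; rewrite ?andbF ?orbF // orbC.
Qed.

Lemma consec_rev q u v : consec (rev q) u v = consec q v u.
Proof.
elim: q => [|a q IHq] //.
rewrite rev_cons -cats1 (consec_cat a) IHq /=.
case: q {IHq} => [|b q] //=.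
rewrite rev_cons last_rcons -cats1; case: (rev q) => [|c r] /=;
by rewrite orbC andbC.
Qed.

Lemma next_consec x p u :
  uniq (x :: p) -> u \in x :: p -> u != last x p ->
  consec (x :: p) u (next (x :: p) u).
Proof.
move=> qU uq ul; apply/consecP.
have [p1 [p2 Eq]] : exists p1 p2, x :: p = p1 ++ u :: p2.
  by case/splitPr: uq => p1 p2; exists p1, p2.
case: p2 Eq => [|v p2] Eq.
  by move: ul; rewrite -[last x p]/(last x (x :: p)) Eq last_cat /= eqxx.
have up1 : u \notin p1 by move: qU; rewrite Eq cat_uniq /= => /and3P[_ /norP[]].
have iu : index u (x :: p) = size p1.
  by rewrite Eq index_cat (negbTE up1) /= eqxx addn0.
have -> : next (x :: p) u = v.
  rewrite next_nth iu uq -[nth x p _]/(nth x (x :: p) (size p1).+1) Eq nth_cat.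
  by rewrite ltnNge leqnSn /= subSnn.
by exists p1, p2; rewrite Eq cat_rcons.
Qed.

(** The index of the last vertex is out of range in [p], and the default value [x] of [nth] closes
    the cycle. *)
Lemma next_last x p : uniq (x :: p) -> next (x :: p) (last x p) = x.
Proof. by move=> qU; rewrite next_nth mem_last index_last // nth_default. Qed.

(** Unordered, because the paths below run through some arcs of the cycle backwards. *)
Definition adjacent_in q u v := consec q u v || consec q v u.

End ConsecutivePairs.

Section GoodPaths.

Variables (T : finType) (e : rel T) (n : nat) (K : {set T}).
Hypothesis e_sym : symmetric e.
Hypothesis e_irr : irreflexive e.
Hypothesis longest : forall c, ucycle e c -> size c <= n.

Implicit Types (p q r : seq T) (u v x y : T).

Lemma sorted_cat_nonnil x0 p r : p != [::] -> r != [::] ->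
  sorted e (p ++ r) = [&& sorted e p, e (last x0 p) (head x0 r) & sorted e r].
Proof. by case: p => [|a p] // _; case: r => [|b r] // _; rewrite /= cat_path. Qed.

Lemma sorted_rev_sym q : sorted e (rev q) = sorted e q.
Proof.
have eS : (fun x y => e y x) =2 e by move=> x y; rewrite e_sym.
by rewrite rev_sorted; case: q => //= a q; apply: eq_path.
Qed.

Lemma last_rev_head x0 q : last x0 (rev q) = head x0 q.
Proof. by case: q => // a q; rewrite rev_cons last_rcons. Qed.

Lemma head_rev_last x0 q : head x0 (rev q) = last x0 q.
Proof. by rewrite -last_rev_head revK. Qed.

(* Used with [n] the length of a longest cycle, so that no such path closes up. *)
Definition good_path q x y :=
  [/\ uniq q, sorted e q, n < size q, {subset q <= K} &
      head y q = x /\ last x q = y].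

Lemma good_path_rev q x y : good_path q x y -> good_path (rev q) y x.
Proof.
case=> qU qs qn qK [hq lq]; split; rewrite ?rev_uniq ?sorted_rev_sym ?size_rev //.
  by move=> z; rewrite mem_rev; apply: qK.
by rewrite head_rev_last last_rev_head.
Qed.

(** An edge between the ends would close [c] into a cycle on more than [n] vertices. *)
Lemma good_path_no_close c x0 :
  uniq c -> sorted e c -> n < size c -> ~~ e (last x0 c) (head x0 c).
Proof.
case: c => [|a c] // cU cs cn; apply/negP => /= ac.
have : ucycle e (a :: c) by rewrite /ucycle cU andbT /= rcons_path ac andbT.
by move/longest; rewrite leqNgt cn.
Qed.

Lemma good_path_nonadj q x y : good_path q x y -> ~~ e x y.
Proof.
case=> qU qs qn _ [hq lq]; rewrite e_sym -lq -[X in e _ X]hq.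
have -> : head y q = head x q by case: q qn {qU qs hq lq}.
exact: good_path_no_close.
Qed.

(** A common neighbour off [q] would close [q] into a longer cycle. *)
Lemma good_path_common q x y j : good_path q x y -> e j x -> e j y -> j \in q.
Proof.
case=> qU qs qn _ [hq lq] jx jy; apply/negPn/negP => jq.
have qN : q != [::] by case: q qn {qU qs hq lq jq}.
have hj : head j q = x by case: q qN hq {qU qs qn lq jq}.
have lj : last j q = y by case: q qN lq {qU qs qn hq jq hj}.
have cs : sorted e (j :: q).
  by case: q qN hj qs {qU qn hq lq lj jq} => [|a q] // _ /= ->; rewrite jx.
have := @good_path_no_close (j :: q) j; rewrite cons_uniq jq qU => /(_ isT cs (ltnW qn)).
by rewrite /= lj e_sym jy.
Qed.

(** Otherwise go from [x] to [u], jump to [y], return backwards to [v] and close up with the edge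
    from [v] to [x]: a cycle on all of [q]. *)
Lemma good_path_consec q x y u v : good_path q x y -> consec q u v ->
  e u x -> e u y -> e v x -> e v y -> False.
Proof.
case=> qU qs qn _ [hq lq] /consecP[p1 [p2 qE]] ux uy vx vy.
subst q; have rN z : rcons p1 z != [::] by case: (p1).
have lE : last v p2 = y by rewrite -lq last_cat.
have hE : head v (rcons p1 u) = x by rewrite -hq; case: (p1).
have := @good_path_no_close (rcons p1 u ++ rev (v :: p2)) v.
rewrite cat_uniq rev_uniq (eq_has (a2 := mem (rcons p1 u))) //.
have -> : has (mem (rcons p1 u)) (rev (v :: p2)) = has (mem (rcons p1 u)) (v :: p2).
  by apply: eq_has_r => z; rewrite mem_rev.
rewrite -cat_uniq qU size_cat size_rev -size_cat qn.
rewrite (sorted_cat_nonnil v) ?rN -?size_eq0 ?size_rev // sorted_rev_sym.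
move: qs; rewrite (sorted_cat_nonnil v) ?rN // => /and3P[-> _ ->].
rewrite last_rcons head_rev_last /= lE uy => /(_ isT isT isT).
rewrite last_cat rev_cons last_rcons.
have -> : head v (rcons p1 u ++ rcons (rev p2) v) = x by rewrite -hE; case: (p1).
by rewrite vx.
Qed.

(** The path x..j1 w1..j2 w2..y is reassembled as w1..j2, x..j1, y..w2. The new edges are [j2 x] and
    [j1 y]; only the pairs [(j1, w1)] and [(j2, w2)] are lost. *)
Lemma double_rotation_ordered q x y p1 p2 p3 j1 w1 j2 w2 :
  good_path q x y -> q = rcons p1 j1 ++ rcons p2 j2 ++ w2 :: p3 ->
  head j2 p2 = w1 -> e j1 x -> e j1 y -> e j2 x ->
  exists2 q', good_path q' w1 w2 &
    forall u v, consec q u v ->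
      [|| adjacent_in q' u v, (u == j1) && (v == w1) | (u == j2) && (v == w2)].
Proof.
case=> qU qs qn qK [hq lq] qE hw j1x j1y j2x.
have rN p z : rcons p z != [::] by case: p.
have lE : last w2 p3 = y by rewrite -lq qE !last_cat.
have hE : head w2 (rcons p1 j1) = x by rewrite -hq qE; case: (p1).
have hw' : head w2 (rcons p2 j2) = w1 by rewrite -hw; case: (p2).
exists (rcons p2 j2 ++ rcons p1 j1 ++ rev (w2 :: p3)).
  have pq : perm_eq q (rcons p2 j2 ++ rcons p1 j1 ++ rev (w2 :: p3)).
    rewrite qE perm_sym perm_catCA !perm_cat2l.
    by apply/permPl/perm_rev.
  split.
  - by rewrite -(perm_uniq pq).
  - move: qs; rewrite qE.
    rewrite !(sorted_cat_nonnil w2) ?rN -?size_eq0 ?size_cat ?size_rcons ?size_rev //.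
    rewrite sorted_rev_sym last_rcons !last_rcons head_rev_last => /and5P[-> _ -> _ ->].
    have -> : head w2 (rcons p1 j1 ++ rev (w2 :: p3)) = x by rewrite -hE; case: (p1).
    by rewrite j2x /= lE j1y.
  - by rewrite -(perm_size pq).
  - by move=> z; rewrite -(perm_mem pq); apply: qK.
  split; first by rewrite -hw'; case: (p2).
  by rewrite !last_cat rev_cons last_rcons.
move=> u v; rewrite qE !(consec_cat w2) last_rcons.
have -> : head w2 (rcons p2 j2 ++ w2 :: p3) = w1 by rewrite -hw'; case: (p2).
rewrite /adjacent_in !(consec_cat w2) !consec_rev last_rcons.
case/or3P=> [->||/and4P[_ _ /eqP<- /eqP<-]]; rewrite ?eqxx ?orbT //.
case/or3P=> [->|->|/and4P[_ _ /eqP<- /eqP<-]]; rewrite ?eqxx ?orbT //.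
Qed.

(** The two arcs may occur on [q] in either order. If [(j2, w2)] comes first, the roles are
    exchanged and the resulting path is reversed. *)
Lemma double_rotation q x y j1 w1 j2 w2 : good_path q x y ->
  consec q j1 w1 -> consec q j2 w2 -> w1 != w2 -> j1 != w2 -> j2 != w1 ->
  e j1 x -> e j1 y -> e j2 x -> e j2 y ->
  exists2 q', good_path q' w1 w2 &
    forall u v, consec q u v ->
      [|| adjacent_in q' u v, (u == j1) && (v == w1) | (u == j2) && (v == w2)].
Proof.
move=> gq c1 c2 w12 j1w2 j2w1 j1x j1y j2x j2y.
have [p1 [r qE]] := consecP _ _ _ c1.
have c2E := c2; rewrite qE (consec_cat w1) last_rcons in c2E.
case/or3P: c2E => [c2'|c2'|/and4P[_ _ _ /= /eqP w1E]]; last by rewrite w1E eqxx in w12.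
- have [p0 [r0 p1E]] := consecP _ _ _ c2'.
  have : last w2 (rcons p1 j1) = last w2 r0 by rewrite p1E last_cat.
  case/lastP: r0 p1E => [|r0 z] p1E; rewrite ?last_rcons /=.
    by move=> j1E; rewrite j1E eqxx in j1w2.
  move=> zE; rewrite -{z}zE -rcons_cons in p1E.
  have [|q' gq' q'P] := @double_rotation_ordered q x y p0 (w2 :: r0) r j2 w2 j1 w1
    gq _ erefl j2x j2y j1x; first by rewrite qE p1E -catA.
  exists (rev q'); first exact: good_path_rev.
  move=> u v /q'P; rewrite /adjacent_in !consec_rev => /or3P[|->|->]; rewrite ?orbT //.
  by rewrite orbC => ->.
have [p2 [p3 rE]] := consecP _ _ _ c2'.
case: p2 rE => [|a p2] [aE rE]; first by rewrite aE eqxx in j2w1.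
apply: (@double_rotation_ordered q x y p1 (a :: p2) p3) gq _ _ _ _ _ => //=.
by rewrite qE aE rE.
Qed.

End GoodPaths.

(** * Components and cyclic successors *)

Section Components.

Variables (T : finType) (e : rel T).
Hypothesis e_sym : symmetric e.
Implicit Types (S I : {set T}).

Lemma del_rel_sym S : symmetric (del_rel e S).
Proof. by move=> x y; rewrite /del_rel /= e_sym andbCA. Qed.

Lemma del_connect_sym S : connect_sym (del_rel e S).
Proof. exact: sym_connect_sym (@del_rel_sym S). Qed.

Lemma del_connect_notin S x y : connect (del_rel e S) x y -> x \notin S -> y \notin S.
Proof. by apply: (connect_inv (P := fun t => t \notin S)) => u v _ /and3P[]. Qed.

Lemma del_connect_sub S S' x y :
  S \subset S' -> connect (del_rel e S') x y -> connect (del_rel e S) x y.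
Proof.
move=> sSS'; apply: connect_sub => u v /and3P[uS vS uv]; apply: connect1.
by apply/and3P; split=> //; [move: uS | move: vS]; apply: contra; apply: (subsetP sSS').
Qed.

Lemma component_mem S x : x \notin S ->
  [set y in ~: S | connect (del_rel e S) x y] \in components e S.
Proof. by move=> xS; apply: imset_f; rewrite inE. Qed.

Lemma leq_card_components S I : I \subset ~: S ->
  {in I &, forall x y, connect (del_rel e S) x y -> x = y} ->
  #|I| <= #|components e S|.
Proof.
move=> /subsetP IS Iinj.
pose f x := [set y in ~: S | connect (del_rel e S) x y].
rewrite -(@card_in_imset _ _ f); first last.
  move=> x y xI yI fxy; apply: Iinj => //.
  have: y \in f y by rewrite inE connect0 andbT IS.
  by rewrite -fxy inE => /andP[].
apply/subset_leq_card/subsetP=> _ /imsetP[x xI ->].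
by apply: component_mem; rewrite -in_setC IS.
Qed.

(** A walk from [y] never leaves the component of [y], so it survives the restriction. *)
Lemma connect_component (r : rel T) y a b : symmetric r ->
  connect r y a -> connect r y b ->
  connect (restrict [set w | connect r y w] r) a b.
Proof.
move=> rS; pose W := [set w | connect r y w].
have main t : connect r y t -> connect (restrict W r) y t.
  move=> yt; suff /andP[] : connect r y t && connect (restrict W r) y t by [].
  have := conj (connect0 r y) (connect0 (restrict W r) y) => /andP.
  apply: (connect_inv (P := fun t => connect r y t && connect (restrict W r) y t)) yt.
  move=> u v /andP[yu Wu] ruv; have yv := connect_trans yu (connect1 ruv).
  rewrite yv; apply: connect_trans Wu (connect1 _).
  by rewrite /restrict /= !inE yu yv.
move=> /main ya /main yb; apply: connect_trans yb.
by rewrite (sym_connect_sym (restrict_sym _ rS)).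
Qed.

End Components.

Section NextLemmas.

Variable T : eqType.
Implicit Types (s : seq T).

Lemma next_inj s : uniq s -> injective (next s).
Proof. by move=> sU; apply: can_inj (prev_next sU). Qed.

(** Cuts the cycle open at the arc leaving [a], giving a path from the successor of [a] to [a]. *)
Lemma rot_next s a : uniq s -> a \in s ->
  exists i p, rot i s = next s a :: p /\ last (next s a) p = a.
Proof.
move=> sU as_; have ns : next s a \in s by rewrite mem_next.
have [i p sE] := rot_to ns; exists i, p; split=> //.
have pU : uniq (next s a :: p) by rewrite -sE rot_uniq.
apply: (next_inj pU); rewrite next_last // -sE.
by rewrite (next_rot i sU).
Qed.

Lemma next2_neq s x : uniq s -> 2 < size s -> x \in s -> next s (next s x) != x.
Proof.
move=> sU s_gt2 xs; have [i p sE] := rot_to xs.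
rewrite -!(next_rot i sU) sE.
have: 2 < size (x :: p) by rewrite -sE size_rot.
have: uniq (x :: p) by rewrite -sE rot_uniq.
case: p {sE} => [|a [|b p]] //= /and3P[/norP[xa /norP[xb _]] _ _] _.
by rewrite eqxx [a == x]eq_sym (negbTE xa) eqxx eq_sym.
Qed.

End NextLemmas.

(** * The neighbourhood of a component off a longest cycle *)

Section LongestCycle.

Variables (T : finType) (e : rel T).
Hypothesis e_sym : symmetric e.
Hypothesis e_irr : irreflexive e.
Hypothesis e_free :
  is_free (disjoint_union (path_graph 4) (path_graph 1)) e.
Hypothesis e_tough : forall S : {set T}, cutset e S ->
  7 * num_components e S <= #|S|.

Variables (s : seq T) (v0 : T).
Hypothesis s_cycle : ucycle e s.
Hypothesis s_longest : forall c, ucycle e c -> size c <= size s.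
Hypothesis s_nonnil : s != [::].
Hypothesis v0_notin : v0 \notin s.

Implicit Types (u v w x y : T) (q : seq T) (J L I : {set T}).

Let C := [set x in s].
Let H := [set v | connect (del_rel e C) v0 v].
Let A := [set a in s | [exists h in H, e a h]].
Let gp := good_path e (size s) (C :|: H).

Let s_uniq : uniq s. Proof. by case/andP: s_cycle. Qed.

Lemma next_edge u : u \in s -> e u (next s u).
Proof. by move=> us; apply: next_cycle => //; case/andP: s_cycle. Qed.

Lemma H_notin v : v \in H -> v \notin s.
Proof.
rewrite inE => /del_connect_notin; rewrite /C !inE; exact.
Qed.

Lemma A_in a : a \in A -> a \in s.
Proof. by rewrite inE => /andP[]. Qed.

Lemma A_nbr a : a \in A -> exists2 h, h \in H & e a h.
Proof. by rewrite inE => /andP[_ /existsP[h /andP[hH ah]]]; exists h. Qed.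

Lemma H_nbr h u : h \in H -> e h u -> u \notin A -> u \in H.
Proof.
move=> hH hu; have hs := H_notin hH; rewrite !inE negb_and.
have [us|us _] /= := boolP (u \in s).
  by case/negP; apply/existsP; exists h; rewrite hH e_sym.
move: hH; rewrite inE => /connect_trans; apply; apply: connect1.
by apply/and3P; split=> //; rewrite inE.
Qed.

Lemma H_path h h' : h \in H -> h' \in H ->
  exists p, [/\ path e h p, last h p = h', uniq (h :: p) & {subset h :: p <= H}].
Proof.
move=> hH h'H.
have : connect (del_rel e C) h h'.
  move: hH h'H; rewrite !inE => h1 h2; apply: connect_trans h2.
  by rewrite del_connect_sym.
case/connectP=> p0 p0p ->; have [p pp pU _] := shortenP p0p.
exists p; split=> //.
  by apply: sub_path pp => x y /and3P[].
move=> z zp; rewrite inE; move: hH; rewrite inE => /connect_trans; apply.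
exact: (path_connect pp).
Qed.

Lemma H_path_disjoint h p q : {subset h :: p <= H} -> {subset q <= s} ->
  has (mem q) (h :: p) = false.
Proof.
move=> pH qs; apply/hasPn => z /pH/H_notin; apply: contra; exact: qs.
Qed.

(** Otherwise a path through [H] could be inserted between [a] and its successor, giving a longer
    cycle. *)
Lemma next_A a : a \in A -> next s a \notin A.
Proof.
move=> aA; apply/negP => bA; have as_ := A_in aA.
have [i [p [sE lE]]] := rot_next s_uniq as_.
have [h hH ah] := A_nbr aA; have [h' h'H bh'] := A_nbr bA.
have [t [tp tl tU tH]] := H_path hH h'H.
have memE : next s a :: p =i s by move=> z; rewrite -sE mem_rot.
have pU : uniq (next s a :: p) by rewrite -sE rot_uniq.
have pp : path e (next s a) p.
  have : cycle e (rot i s) by rewrite rot_cycle; case/andP: s_cycle.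
  by rewrite sE /= rcons_path => /andP[].
have : ucycle e ((next s a :: p) ++ h :: t).
  rewrite /ucycle cat_uniq pU tU andbT (@H_path_disjoint h t) //; last first.
    by move=> z; rewrite memE.
  by rewrite /= rcons_path cat_path last_cat pp lE /= ah tp tl e_sym bh'.
by move/s_longest; rewrite size_cat -sE size_rot -{2}[size s]addn0 leq_add2l.
Qed.

(** Follow the cycle from the successor of [a] to [b], cross [H] to [a], and follow the cycle
    backwards from [a] to the successor of [b]. This covers the cycle and at least one vertex of
    [H], and omits only the arcs leaving [a] and [b]. *)
Lemma crossing_path a b : a \in A -> b \in A -> a != b ->
  exists2 q, gp q (next s a) (next s b) &
    forall u, u \in s -> u \notin A -> adjacent_in q u (next s u).
Proof.
move=> aA bA ab; have as_ := A_in aA; have bs := A_in bA.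
have [i [p [sE lE]]] := rot_next s_uniq as_.
have [h hH bh] := A_nbr bA; have [h' h'H ah'] := A_nbr aA.
have [t [tp tl tU tH]] := H_path hH h'H.
set x := next s a in sE lE *; set y := next s b.
have memE : x :: p =i s by move=> z; rewrite -sE mem_rot.
have pU : uniq (x :: p) by rewrite -sE rot_uniq.
have pp : sorted e (x :: p).
  have : cycle e (rot i s) by rewrite rot_cycle; case/andP: s_cycle.
  by rewrite sE /= rcons_path => /andP[].
have nE : next (x :: p) =1 next s by move=> z; rewrite -sE next_rot.
have arc u : u \in s -> u != a -> consec (x :: p) u (next s u).
  by move=> us ua; rewrite -nE; apply: next_consec; rewrite ?memE ?lE.
have ba : b != a by rewrite eq_sym.
have [p1 [p2 pE]] := consecP _ _ _ (arc b bs ba).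
rewrite -/y in pE.
have rN : rcons p1 b != [::] by case: (p1).
have sizeE : size (rcons p1 b) + size (y :: p2) = size s.
  by rewrite -size_cat -pE -sE size_rot.
exists (rcons p1 b ++ (h :: t) ++ rev (y :: p2)).
  split.
  - rewrite catA cat_uniq rev_uniq cat_uniq tU.
    rewrite (@H_path_disjoint h t) //; last first.
      by move=> z zp; rewrite -memE pE mem_cat zp.
    move: pU; rewrite pE cat_uniq => /and3P[-> d ->]; rewrite !andbT /=.
    apply/hasPn => z; rewrite mem_rev => zp.
    rewrite mem_cat negb_or; apply/andP; split.
      by move/hasPn: d => /(_ z zp).
    apply/negP => /tH/H_notin; rewrite -memE pE mem_cat zp orbT //.
  - move: pp; rewrite pE !(sorted_cat_nonnil e y) ?rN -?size_eq0 ?size_cat ?size_rev //.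
    rewrite sorted_rev_sym // last_rcons head_rev_last => /and3P[-> _ ->].
    rewrite /= bh tp tl e_sym andbT /=.
    have -> : last y p2 = a by rewrite -lE -[last x p]/(last x (x :: p)) pE last_cat.
    by rewrite ah'.
  - by rewrite !size_cat size_rev addnCA sizeE -[X in X < _]add0n ltn_add2r.
  - move=> z; rewrite !mem_cat mem_rev in_setU [z \in C]inE => /or3P[zp|/tH->|zp].
    + by rewrite -memE pE mem_cat zp.
    + by rewrite orbT.
    + by rewrite -memE pE mem_cat zp orbT.
  split.
    have : head y (x :: p) = x by [].
    by rewrite pE; case: (p1).
  by rewrite !last_cat rev_cons last_rcons.
move=> u us uA.
have ua : u != a by apply: contraNneq uA => ->.
have ub : u != b by apply: contraNneq uA => ->.
have := arc u us ua; rewrite pE /adjacent_in !(consec_cat y) !consec_rev last_rcons.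
case/or3P=> [->|->|/and4P[_ _ /eqP ubE _]]; rewrite ?orbT //.
by rewrite ubE eqxx in ub.
Qed.

(** [v0] has no neighbour outside [A :|: H], so it would complete an induced path there to the
    forbidden graph. *)
Lemma P4_free_outside : P4_free_on (~: (A :|: H)) e.
Proof.
move=> a b c d aF bF cF dF ab bc cd ac ad bd; apply: e_free.
have nH z : z \in ~: (A :|: H) -> e z v0 = false.
  rewrite !inE negb_or => /andP[zA zH]; apply/negP => zv.
  have v0H : v0 \in H by rewrite inE connect0.
  have := H_nbr v0H; rewrite e_sym in zv => /(_ z zv).
  by rewrite !inE => /(_ zA); apply/negP.
have nHs z : z \in ~: (A :|: H) -> e v0 z = false by move=> zF; rewrite e_sym nH.
pose f (i : 'I_4 + 'I_1) := match i with inl i => nth v0 [:: a; b; c; d] i | _ => v0 end.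
pose g := disjoint_union (path_graph 4) (path_graph 1).
have fE i k : e (f i) (f k) = g i k.
  have [ba cb dc] : [/\ e b a, e c b & e d c] by rewrite (e_sym b) (e_sym c) (e_sym d).
  have [ca da db] : [/\ e c a = false, e d a = false & e d b = false].
    by rewrite (e_sym c) !(e_sym d) (negbTE ac) (negbTE ad) (negbTE bd).
  case: i k => [[[|[|[|[|?]]]] ?]|[[|?] ?]] [[[|[|[|[|?]]]] ?]|[[|?] ?]] //=;
  by rewrite ?e_irr ?(nH, nHs) // ?(negbTE ac, negbTE ad, negbTE bd, ca, da, db).
exists f; split=> // i k fik.
(* Injectivity holds because the five vertices of the pattern have pairwise different neighbourhoods
   in its path. *)
have rows z : g i z = g k z by rewrite -!fE fik.
have := rows (inl (@Ordinal 4 0 isT)); have := rows (inl (@Ordinal 4 1 isT)).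
have := rows (inl (@Ordinal 4 2 isT)); have := rows (inl (@Ordinal 4 3 isT)).
case: i k {fik rows} => [[[|[|[|[|?]]]] ?]|[[|?] ?]] [[[|[|[|[|?]]]] ?]|[[|?] ?]] //= *;
  by [congr inl; apply: val_inj | congr inr; apply: val_inj].
Qed.

Lemma not_connected_out (S : {set T}) u w : u \notin S -> w \notin S ->
  ~~ connect (del_rel e S) u w -> 14 <= #|S|.
Proof.
move=> uS wS nuw; have cS : cutset e S.
  have uw : u != w by apply: contraNneq nuw => ->.
  rewrite /cutset /num_components -[2]/((true : nat).+1) -uw -cards2.
  apply: leq_card_components; first by rewrite subUset !sub1set !inE uS.
  move=> x y /set2P[]-> /set2P[]-> // => [cuw|cwu]; first by rewrite cuw in nuw.
  by rewrite del_connect_sym ?cwu // in nuw.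
by apply: leq_trans (e_tough cS); rewrite (leq_mul2l 7 2).
Qed.

Lemma connect_out_H J x y : A \subset J -> connect (del_rel e J) x y ->
  x \notin H -> y \notin H.
Proof.
move=> /subsetP AJ; apply: (connect_inv (P := fun t => t \notin H)).
move=> u v uH /and3P[uJ _ uv]; apply: contra uH => vH.
apply: (H_nbr vH); first by rewrite e_sym.
by apply: contra uJ; apply: AJ.
Qed.

(** [A] separates [v0] from the vertices of the cycle outside [A], and such vertices exist by
    [next_A]. *)
Lemma card_A : 14 <= #|A|.
Proof.
have [c cs cA] : exists2 c, c \in s & c \notin A.
  have [c cs] : exists c, c \in s.
    by case: (s) s_nonnil => // c ? _; exists c; rewrite mem_head.
  have [cA|cA] := boolP (c \in A); last by exists c.
  by exists (next s c); rewrite ?mem_next ?next_A.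
have cH : c \notin H by apply: contraL cs => /H_notin.
have v0H : v0 \in H by rewrite inE connect0.
have v0A : v0 \notin A by apply: contra v0_notin => /A_in.
apply: (not_connected_out cA v0A); apply/negP => cv0.
by have := connect_out_H (subxx A) cv0 cH; rewrite v0H.
Qed.

Lemma size_s : 2 < size s.
Proof.
have : #|A| <= size s.
  rewrite -(card_uniqP s_uniq); apply/subset_leq_card/subsetP => a; exact: A_in.
by move=> As; apply: leq_trans As; apply: leq_trans card_A.
Qed.

(** * Separators and the splitting of components *)

Definition keeps q L := forall u, u \in s -> u \notin L -> adjacent_in q u (next s u).

(* [J] is the set J of the header, deleted together with [A]. An element [u] of
   [L] stands for the arc [(u, next s u)] of the cycle: [L] collects the arcs that
   the paths attached to the components may have lost through rotations. *)
Definition separator J L :=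
  [/\ J \subset C :\: A,
      forall u, u \in s -> u \notin L -> ~~ ((u \in J) && (next s u \in J)) &
      forall v, v \notin A :|: J -> v \notin H -> exists q x y,
        [/\ gp q x y, keeps q L & forall j w, j \in J ->
          connect (del_rel e (A :|: J)) v w -> e j w ->
          [/\ e j x, e j y & forall w', connect (del_rel e (A :|: J)) v w' -> e j w']]].

(** [W] is the component of [y1] and [M] the co-component of [y1] in [W]; [M] also contains [y2],
    which is not adjacent to [y1]. By Seinsche's theorem [W] is not co-connected, so [N = W :\: M]
    is nonempty, and [M], being co-connected, is disconnected. Deleting [N] therefore splits [W],
    and [q] becomes the path attached to the pieces. *)
Lemma separator_split J L L1 y1 y2 q : separator J L ->
  y1 \notin A :|: J -> y1 \notin H -> connect (del_rel e (A :|: J)) y1 y2 ->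
  y1 != y2 -> gp q y1 y2 -> L \subset L1 -> keeps q L1 ->
  exists J', [/\ separator J' L1, J \proper J',
    forall j, j \in J' :\: J -> connect (del_rel e (A :|: J)) y1 j /\ e j y1 &
    exists m1 m2, [/\ connect (del_rel e (A :|: J)) y1 m1,
      connect (del_rel e (A :|: J)) y1 m2, m1 \notin A :|: J', m2 \notin A :|: J' &
      ~~ connect (del_rel e (A :|: J')) m1 m2]].
Proof.
move=> [JC JL Jq] y1S y1H y12 y12N gq LL1 qL1.
set S := A :|: J in y1S y12 *.
pose W := [set w | connect (del_rel e S) y1 w].
have WS w : w \in W -> w \notin S.
  by rewrite inE => /del_connect_notin; apply.
have WH w : w \in W -> w \notin H.
  by rewrite inE => /(connect_out_H (subsetUl A J)); apply.
have WF : P4_free_on W e.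
  have WF w : w \in W -> w \in ~: (A :|: H).
    move=> wW; rewrite !in_setC in_setU negb_or WH // andbT.
    by apply: contra (WS w wW); rewrite /S in_setU => ->.
  by move=> a b c d aW bW cW dW; apply: P4_free_outside; apply: WF.
have y1W : y1 \in W by rewrite inE connect0.
have y2W : y2 \in W by rewrite inE.
have Wtrans w z : w \in W -> z \notin S -> e w z -> z \in W.
  move=> wW zS wz; have wS := WS w wW; move: wW; rewrite !inE => yw.
  by apply: connect_trans yw (connect1 _); apply/and3P.
have Wconn : {in W &, forall a b, connect (restrict W e) a b}.
  move=> a b; rewrite ![_ \in W]inE => ya yb.
  apply: connect_sub (connect_component (del_rel_sym e_sym S) ya yb) => u v.
  by case/and3P=> uW vW /and3P[_ _ uv]; apply: connect1; apply/and3P.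
pose M := [set w | connect (restrict W (co_rel e)) y1 w].
have rcS : symmetric (restrict W (co_rel e)) by apply/restrict_sym/co_rel_sym.
have MW w : w \in M -> w \in W by rewrite inE => /connect_restrict_mem; apply.
have Mco : {in M &, forall a b, connect (restrict M (co_rel e)) a b}.
  move=> a b; rewrite ![_ \in M]inE => ya yb.
  apply: connect_sub (connect_component rcS ya yb) => u v.
  by case/and3P=> uM vM /and3P[_ _ uv]; apply: connect1; apply/and3P.
have y1M : y1 \in M by rewrite inE connect0.
have y2M : y2 \in M.
  rewrite inE connect1 //; apply/and3P; split=> //.
  by rewrite /co_rel /= y12N; apply: good_path_nonadj gq.
have gt1 (D : {set T}) : y1 \in D -> y2 \in D -> 1 < #|D|.
  by move=> y1D y2D; apply/card_gt1P; exists y1, y2.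
have NM j m : j \in W -> j \notin M -> m \in M -> e j m.
  move=> jW jM mM; have jm : j != m by apply: contraNneq jM => ->.
  apply: contraNT jM => njm; have mW := MW m mM; move: mM; rewrite !inE => ym.
  apply: connect_trans ym (connect1 _); apply/and3P; split=> //.
  by rewrite /co_rel /= eq_sym jm e_sym.
have [j0 j0W j0M] : exists2 j, j \in W & j \notin M.
  have [/subsetP sWM|/subsetPn[j]] := boolP (W \subset M); last by exists j.
  have WM : W = M by apply/setP=> w; apply/idP/idP; [apply: sWM | apply: MW].
  exfalso; apply: (P4_free_connected e_sym e_irr WF (gt1 W y1W y2W) Wconn).
  by rewrite WM.
have [m1 m1M [m2 m2M m12]] : exists2 m1, m1 \in M &
    exists2 m2, m2 \in M & ~~ connect (restrict M e) m1 m2.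
  have [/forall_inP Mconn|/forall_inPn[m1 m1M /forall_inPn[m2 m2M m12]]] :=
    boolP [forall m1 in M, forall m2 in M, connect (restrict M e) m1 m2].
    exfalso; apply: (P4_free_connected e_sym e_irr _ (gt1 M y1M y2M) _ Mco).
      move=> a b c d aM bM cM dM; apply: WF; exact: MW.
    by move=> a b aM bM; have /forall_inP/(_ b bM) := Mconn a aM.
  by exists m1 => //; exists m2.
(* From the path attached to [W] so far, only this is retained: a vertex of [J] with a neighbour in
   [W] is complete to [W]. *)
have [q0 [x0 [z0 [_ _ q0P]]]] := Jq y1 y1S y1H.
pose N := W :\: M.
have NW j : j \in N -> j \in W by case/setDP.
have Nadj j m : j \in N -> m \in M -> e j m by case/setDP=> jW jM; apply: NM.
have Jadj j w w' : j \in J -> w \in W -> e j w -> w' \in W -> e j w'.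
  move=> jJ; rewrite inE => yw jw; rewrite inE => yw'.
  by have [_ _] := q0P j w jJ yw jw; apply.
pose J' := J :|: N.
have SJ' : A :|: J' = S :|: N by rewrite /J' setUA.
have notJ w : w \in W -> w \notin J.
  by move/WS; rewrite /S in_setU negb_or => /andP[].
have MJ' m : m \in M -> m \notin A :|: J'.
  move=> mM; rewrite SJ' in_setU negb_or WS ?MW //=.
  by rewrite in_setD mM.
have Mstay m t : m \in M -> connect (del_rel e (A :|: J')) m t ->
    t \in M /\ connect (restrict M e) m t.
  move=> mM mt; apply/andP.
  apply: (connect_inv (P := fun t => (t \in M) && connect (restrict M e) m t)) mt _;
    last by rewrite mM connect0.
  move=> u v /andP[uM mu] /and3P[_ vJ' uv].
  have vM : v \in M.
    move: vJ'; rewrite SJ' in_setU negb_or => /andP[vS].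
    by rewrite in_setD negb_and negbK (Wtrans u v (MW u uM) vS uv) orbF.
  rewrite vM; apply: connect_trans mu (connect1 _); exact/and3P.
exists J'; split.
- split.
  + rewrite subUset JC; apply/subsetP=> j jN; have jW := NW j jN.
    (* A vertex of [N] is a common neighbour of the ends, so it lies on [q], hence in [C :|: H];
       being in [W], it avoids [H] and [A]. *)
    have jq : j \in q by apply: good_path_common gq _ _; rewrite // Nadj.
    have [_ _ _ qK _] := gq; have := qK j jq.
    rewrite in_setU (negbTE (WH j jW)) orbF => jC; rewrite in_setD jC andbT.
    by have := WS j jW; rewrite /S in_setU negb_or => /andP[].
  + move=> u us uL1; apply/negP=> /andP[uJ' nJ'].
    have uv := next_edge us; set v := next s u in uv nJ'.
    have endsN j : j \in N -> e j y1 /\ e j y2 by move=> jN; split; apply: Nadj.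
    have endsJ j k : j \in J -> k \in N -> e j k -> e j y1 /\ e j y2.
      by move=> jJ /NW kW jk; split; apply: (Jadj j k).
    have uL : u \notin L by apply: contra uL1; apply: (subsetP LL1).
    (* Since [u] is not in [L], one of [u], [v] is in [N]. The other is in [N] too, or in [J] with a
       neighbour in [W]; so both are adjacent to both ends of [q], on which they are consecutive. *)
    have [ends1 ends2] : (e u y1 /\ e u y2) /\ (e v y1 /\ e v y2).
      case/setUP: uJ' nJ' => [uJ|uN] /setUP[vJ|vN].
      - by have := JL u us uL; rewrite uJ vJ.
      - by split; [apply: (endsJ u v) | apply: endsN].
      - by split; [apply: endsN | apply: (endsJ v u) => //; rewrite e_sym].
      - by split; apply: endsN.
    have [u1 u2] := ends1; have [v1 v2] := ends2.
    case/orP: (qL1 u us uL1) => c.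
      exact: (good_path_consec e_sym s_longest gq c).
    exact: (good_path_consec e_sym s_longest gq c).
  + move=> v vS' vH; have [vW|vW] := boolP (v \in W).
      have vM : v \in M.
        by move: vS'; rewrite SJ' !in_setU in_setD vW andbT !negb_or negbK => /andP[].
      exists q, y1, y2; split=> // j w /setUP[jJ|jN] /(Mstay v _ vM)[wM _] jw.
        have jW w' : w' \in W -> e j w' by apply: (Jadj j w) => //; apply: MW.
        by split; rewrite ?jW // => w' /(Mstay v _ vM)[/MW/jW].
      split; rewrite ?Nadj // => w' /(Mstay v _ vM)[w'M _]; exact: Nadj.
    (* A component other than [W] keeps its path: [N] lies in [W] and has no neighbour there. *)
    have SS' : S \subset A :|: J' by rewrite SJ' subsetUl.
    have vS : v \notin S by apply: contra vS'; apply: (subsetP SS').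
    have [q' [x' [z' [gq' kq' q'P]]]] := Jq v vS vH.
    exists q', x', z'; split=> //.
      move=> u us uL1; apply: kq' => //; apply: contra uL1; exact: (subsetP LL1).
    move=> j w /setUP[jJ|jN] /(del_connect_sub SS') vw jw.
      have [jx jz jv] := q'P j w jJ vw jw.
      by split=> // w' /(del_connect_sub SS'); apply: jv.
    have wS := del_connect_notin vw vS.
    have := Wtrans j w (NW j jN) wS jw; rewrite inE => yw.
    case/negP: vW; rewrite inE; apply: connect_trans yw _.
    by rewrite del_connect_sym.
- rewrite properE subsetUl; apply/subsetPn; exists j0; last exact: notJ.
  by rewrite in_setU in_setD j0W j0M orbT.
- move=> j /setDP[/setUP[jJ|jN] jJ']; first by rewrite jJ in jJ'.
  by split; [have := NW j jN; rewrite inE | apply: Nadj].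
exists m1, m2; split; rewrite ?MJ' //.
- by have := MW m1 m1M; rewrite inE.
- by have := MW m2 m2M; rewrite inE.
by apply: contra m12 => /(Mstay m1 _ m1M)[].
Qed.

(** Crossing paths omit only arcs leaving [A]. Arcs entering [A] are added so that the successor of
    a vertex of [J] outside [L0] avoids [A]. *)
Let L0 := [set u in s | (u \in A) || (next s u \in A)].

Lemma L0_notin u : u \in s -> u \notin L0 -> (u \notin A) && (next s u \notin A).
Proof. by move=> us; rewrite [u \in L0]inE us /= negb_or. Qed.

(** Starting from the empty set, any component containing two successors is split along their
    crossing path. Each split enlarges [J], so the process stops. *)
Lemma separator_A : exists J,
  [/\ separator J L0, forall a, a \in A -> next s a \notin J &
      {in A &, forall a b, connect (del_rel e (A :|: J)) (next s a) (next s b) -> a = b}].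
Proof.
suff main k J : #|~: J| <= k -> separator J L0 -> (forall a, a \in A -> next s a \notin J) ->
    exists J, [/\ separator J L0, forall a, a \in A -> next s a \notin J &
      {in A &, forall a b, connect (del_rel e (A :|: J)) (next s a) (next s b) -> a = b}].
  apply: (main #|~: set0 : {set T}| set0); rewrite ?leqnn //; last by move=> a _; rewrite inE.
  have /card_gt1P[a [b [aA bA ab]]] : 1 < #|A| by apply: leq_trans card_A.
  have [q gq qP] := crossing_path aA bA ab.
  split; first exact: sub0set.
    by move=> u _ _; rewrite inE.
  move=> v _ _; exists q, (next s a), (next s b); split=> //.
    by move=> u us /(L0_notin us)/andP[uA _]; apply: qP.
  by move=> j w; rewrite inE.
elim: k J => [|k IHk] J leJ sJ JA.
  have [a aA] : exists a, a \in A by apply/card_gt0P; apply: leq_trans card_A.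
  have := JA a aA; rewrite -in_setC; move: leJ; rewrite leqn0 cards_eq0 => /eqP->.
  by rewrite inE.
have [/forall_inP sep|/forall_inPn[a aA /forall_inPn[b bA]]] := boolP
  [forall a in A, forall b in A,
     connect (del_rel e (A :|: J)) (next s a) (next s b) ==> (a == b)].
  exists J; split=> // a b aA bA cab; apply/eqP.
  by have /forall_inP/(_ b bA)/implyP/(_ cab) := sep a aA.
rewrite negb_imply => /andP[cab ab].
have [q gq qP] := crossing_path aA bA ab.
have out c : c \in A -> (next s c \notin A :|: J) && (next s c \notin H).
  move=> cA; rewrite in_setU negb_or next_A // JA //=.
  by apply: contraL (A_in cA) => /H_notin; rewrite mem_next.
have /andP[naS naH] := out a aA.
have nab : next s a != next s b by rewrite (inj_eq (next_inj s_uniq)).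
have [|J' [sJ' JJ' J'a _]] := separator_split sJ naS naH cab nab gq (subxx L0) _.
  by move=> u us /(L0_notin us)/andP[uA _]; apply: qP.
apply: (IHk J') => //.
  by rewrite -ltnS; apply: leq_trans leJ; apply: proper_card; rewrite properC.
(* A newly deleted vertex is adjacent to [next s a], whereas the ends of a crossing path are not
   adjacent; so no successor is deleted. *)
move=> c cA; apply/negP => cJ'.
have [_ ca] : connect (del_rel e (A :|: J)) (next s a) (next s c) /\ e (next s c) (next s a).
  by apply: J'a; rewrite in_setD cJ' JA.
have [cE|cNa] := eqVneq c a; first by rewrite cE e_irr in ca.
have [q' gq' _] := crossing_path cA aA cNa.
by move: (good_path_nonadj e_sym s_longest gq'); rewrite ca.
Qed.

(** [I] picks vertices in distinct components. Each further split adds at most two arcs to [L] and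
    raises the size of [I] by at least one, so both numerical bounds persist. The induction is on
    the number of vertices outside [J]. *)
Lemma separator_no_transversal J L I : separator J L -> L0 \subset L ->
  I \subset ~: (A :|: J) ->
  {in I &, forall x y, connect (del_rel e (A :|: J)) x y -> x = y} ->
  #|A| <= #|I| -> #|L| <= 2 * #|I| -> False.
Proof.
elim: {J}#|~: J| {-2}J (leqnn #|~: J|) L I => [|k IHk] J leJ L I sJ L0L IS Iinj AI LI.
  have /subset_leq_card : [set v0] \subset ~: J.
    rewrite sub1set in_setC; have [/subsetP JC _ _] := sJ.
    by apply: contra v0_notin => /JC; rewrite !inE => /andP[].
  by rewrite cards1 ltnNge leJ.
set S := A :|: J in IS Iinj.
have [JC JL Jq] := sJ.
have Jarc u : u \in J :\: L -> [/\ u \in s, u \notin L, u \in J,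
    next s u \notin S & next s u \notin H].
  case/setDP=> uJ uL; have /setDP[uC _] := subsetP JC u uJ.
  have us : u \in s by rewrite inE in uC.
  split=> //.
    rewrite /S in_setU negb_or; apply/andP; split.
      by have /andP[] := L0_notin us (contra (subsetP L0L u) uL).
    by have := JL u us uL; rewrite uJ.
  by apply: contraL us => /H_notin; rewrite mem_next.
(* If [u1] and [u2] were distinct, a double rotation would split their common component and the
   induction hypothesis would apply. *)
have step q x y u1 u2 : gp q x y -> keeps q L ->
    (forall j w, j \in J -> connect (del_rel e S) (next s u1) w -> e j w -> e j x /\ e j y) ->
    u1 \in J :\: L -> u2 \in J :\: L ->
    connect (del_rel e S) (next s u1) (next s u2) ->
    consec q u1 (next s u1) -> consec q u2 (next s u2) -> u1 = u2.
  move=> gq kq qP u1J u2J w12 c1 c2; apply/eqP/negPn/negP=> u12.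
  have [u1s u1L u1J' w1S w1H] := Jarc u1 u1J.
  have [u2s u2L u2J' w2S w2H] := Jarc u2 u2J.
  have [u1x u1y] := qP u1 _ u1J' (connect0 _ _) (next_edge u1s).
  have [u2x u2y] := qP u2 _ u2J' w12 (next_edge u2s).
  have w12N : next s u1 != next s u2 by rewrite (inj_eq (next_inj s_uniq)).
  have notJ u w : u \in J -> w \notin S -> u != w.
    by move=> uJ; apply: contraNneq => <-; rewrite in_setU uJ orbT.
  have [q' gq' q'P] := double_rotation e_sym gq c1 c2 w12N (notJ _ _ u1J' w2S)
    (notJ _ _ u2J' w1S) u1x u1y u2x u2y.
  pose L1 := u1 |: (u2 |: L).
  have kq' : keeps q' L1.
    move=> u us; rewrite !in_setU1 !negb_or => /and3P[uu1 uu2 uL].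
    (* A lost pair cannot be the arc [(u, next s u)] read backwards, as the cycle has more than two
       vertices. *)
    have n2 v : v \in s -> (next s u == v) && (u == next s v) = false.
      move=> vs; apply/negP => /andP[/eqP<- /eqP uE].
      by have := next2_neq s_uniq size_s us; rewrite -uE eqxx.
    case/orP: (kq u us uL) => /q'P; rewrite ?(negbTE uu1) ?(negbTE uu2) ?n2 // !orbF //.
    by rewrite /adjacent_in orbC.
  have L1L : L \subset L1 by rewrite /L1 setUA subsetUr.
  have [J' [sJ' JJ' J'W [m1 [m2 [ym1 ym2 m1S m2S m12]]]]] :=
    separator_split sJ w1S w1H w12 w12N gq' L1L kq'.
  pose W := [set w | connect (del_rel e S) (next s u1) w].
  (* At most one representative lies in [W]; it is replaced by [m1] and [m2], from different pieces
     of [W]. *)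
  pose I1 := I :\: W.
  have IW : #|I :&: W| <= 1.
    apply/card_le1_eqP => x' y' /setIP[xI]; rewrite inE => xW /setIP[yI]; rewrite inE => yW.
    by apply: Iinj => //; apply: connect_trans xW; rewrite del_connect_sym.
  have m1I : m1 \notin I1 by rewrite !inE ym1.
  have m2I : m2 \notin I1 by rewrite !inE ym2.
  have m12N : m1 != m2 by apply: contraNneq m12 => ->.
  have cI' : #|m1 |: (m2 |: I1)| = #|I1|.+2.
    by rewrite !cardsU1 in_setU1 negb_or m12N m1I m2I.
  have cI1 : #|I| <= #|I1|.+1 by rewrite -(cardsID W I); apply: leq_add IW (leqnn _).
  have SS' : S \subset A :|: J' by apply: setUS; apply: proper_sub.
  apply: (IHk J' _ L1 (m1 |: (m2 |: I1))) => //.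
  - by rewrite -ltnS; apply: leq_trans leJ; apply: proper_card; rewrite properC.
  - exact: subset_trans L0L L1L.
  - apply/subsetP=> z /setU1P[->|/setU1P[->|/setDP[zI zW]]]; rewrite in_setC //.
    have := subsetP IS z zI; rewrite /S !inE !negb_or => /andP[-> zJ] /=.
    apply: contra zW => zJ'; rewrite inE; apply: (J'W z _).1.
    by rewrite in_setD zJ.
  - have mI1 m z : m \in W -> z \in I1 -> ~~ connect (del_rel e (A :|: J')) m z.
      rewrite inE => ym /setDP[_]; rewrite inE; apply: contra => mz.
      exact: connect_trans ym (del_connect_sub SS' mz).
    have m1W : m1 \in W by rewrite inE.
    have m2W : m2 \in W by rewrite inE.
    move=> z z' /setU1P[->|/setU1P[->|zI]] /setU1P[->|/setU1P[->|zI']] //.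
    + by move=> c; rewrite c in m12.
    + by move=> c; have := mI1 m1 z' m1W zI'; rewrite c.
    + by rewrite del_connect_sym // => c; rewrite c in m12.
    + by move=> c; have := mI1 m2 z' m2W zI'; rewrite c.
    + by rewrite del_connect_sym // => c; have := mI1 m1 z m1W zI; rewrite c.
    + by rewrite del_connect_sym // => c; have := mI1 m2 z m2W zI; rewrite c.
    + move=> /(del_connect_sub SS'); apply: Iinj; by [case/setDP: zI | case/setDP: zI'].
  - by rewrite cI'; apply: leq_trans AI _; apply: leq_trans cI1 _.
  rewrite cI'; have : #|L1| <= #|L|.+2.
    rewrite /L1 !cardsU1 -[#|L|.+2]/(1 + (1 + #|L|)).
    exact: leq_add (leq_b1 _) (leq_add (leq_b1 _) (leqnn _)).
  move: cI1 LI; move: #|L1| #|L| #|I| #|I1|; clear; lia.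
pose c := #|components e S|.
have Ic : #|I| <= c by apply: leq_card_components.
have Ac : #|A| <= c := leq_trans AI Ic.
have Sc : 7 * c <= #|S|.
  by apply: e_tough; rewrite /cutset; apply: leq_trans Ac; apply: leq_trans card_A.
pose f u := [set w in ~: S | connect (del_rel e S) (next s u) w].
(* Sort the vertices of [J :\: L] by the component of their successor. By [step], each component
   receives at most one arc for each direction in which its path can traverse it. *)
have E1 : #|J :\: L| <= 2 * c.
  rewrite -sum1_card (partition_big f (mem (components e S))) /=; last first.
    by move=> u /Jarc[_ _ _ uS _]; apply: component_mem.
  rewrite mulnC -sum_nat_const; apply: leq_sum => W _; rewrite sum1dep_card.
  set B := [set u in _ | _].
  have [->|[u0 u0B]] := set_0Vmem B; first by rewrite cards0.
  have BE u : u \in B -> u \in J :\: L /\ f u = W.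
    by rewrite inE => /andP[uJ /eqP].
  have [u0J u0W] := BE u0 u0B; have [_ _ _ w0S w0H] := Jarc u0 u0J.
  have [q [x [y [gq kq qP]]]] := Jq (next s u0) w0S w0H.
  have Bc u v : u \in B -> v \in B -> connect (del_rel e S) (next s u) (next s v).
    move=> /BE[uJ uW] /BE[vJ vW]; have [_ _ _ vS _] := Jarc v vJ.
    have : next s v \in f v by rewrite inE connect0 in_setC vS.
    by rewrite vW -uW inE => /andP[].
  have BP u : u \in B -> forall j w, j \in J -> connect (del_rel e S) (next s u) w ->
      e j w -> e j x /\ e j y.
    move=> uB j w jJ uw jw.
    by have [] := qP j w jJ (connect_trans (Bc u0 u u0B uB) uw) jw.
  pose B1 := [set u in B | consec q u (next s u)].
  pose B2 := [set u in B | consec q (next s u) u].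
  have BB : B \subset B1 :|: B2.
    apply/subsetP=> u uB; have [/Jarc[us uL _ _ _] _] := BE u uB.
    by apply/setUP; case/orP: (kq u us uL) => cu; [left | right]; rewrite inE uB.
  have B1le : #|B1| <= 1.
    apply/card_le1_eqP => v u; rewrite [v \in _]inE [u \in _]inE => /andP[vB cv] /andP[uB cu].
    have [[uJ _] [vJ _]] := (BE u uB, BE v vB).
    exact: (step q x y) gq kq (BP u uB) uJ vJ (Bc u v uB vB) cu cv.
  have B2le : #|B2| <= 1.
    apply/card_le1_eqP => v u; rewrite [v \in _]inE [u \in _]inE => /andP[vB cv] /andP[uB cu].
    have [[uJ _] [vJ _]] := (BE u uB, BE v vB).
    apply: (step (rev q) y x) _ _ _ uJ vJ (Bc u v uB vB) _ _; rewrite ?consec_rev //.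
    - exact: good_path_rev.
    - by move=> z zs zL; rewrite /adjacent_in !consec_rev orbC; apply: kq.
    - by move=> j w jJ cw jw; have [] := BP u uB j w jJ cw jw.
  apply: leq_trans (subset_leq_card BB) _; apply: leq_trans (leq_card_setU _ _) _.
  exact: (leq_add B1le B2le).
have JE : #|J| <= #|J :\: L| + #|L|.
  by rewrite -(cardsID L J) addnC leq_add2l subset_leq_card // subsetIr.
have SE : #|S| <= #|A| + #|J| by apply: leq_card_setU.
have A0 : 0 < #|A| by apply: leq_trans card_A.
(* 7c <= |A| + |J| <= c + (2c + |L|) <= 5c, a contradiction as c > 0. *)
move: c #|S| #|J :\: L| #|J| #|A| #|L| #|I| Ic Ac Sc E1 JE SE A0 AI LI; clear; lia.
Qed.

(** The successors of [A] serve as initial representatives. An arc in [L0] starts in [A] or at a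
    predecessor of [A], so there are at most 2|A| of them. *)
Lemma longest_cycle_spanning : False.
Proof.
have [J [sJ JA Ainj]] := separator_A.
have cI : #|[set next s a | a in A]| = #|A|.
  by rewrite card_imset //; apply: next_inj.
apply: (@separator_no_transversal J L0 [set next s a | a in A]) => //.
- apply/subsetP=> _ /imsetP[a aA ->]; rewrite in_setC in_setU negb_or next_A //=.
  exact: JA.
- by move=> _ _ /imsetP[a aA ->] /imsetP[b bA ->] /(Ainj a b aA bA) ->.
- by rewrite cI.
rewrite cI; have : L0 \subset A :|: [set prev s a | a in A].
  apply/subsetP=> u; rewrite [u \in L0]inE in_setU => /andP[us /orP[->//|nA]].
  by apply/orP; right; apply/imsetP; exists (next s u); rewrite ?prev_next.
move/subset_leq_card/leq_trans; apply; apply: leq_trans (leq_card_setU _ _) _.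
by rewrite mul2n -addnn leq_add2l leq_imset_card.
Qed.

End LongestCycle.

(** * From toughness to a Hamiltonian cycle *)

Import Order.TTheory GRing.Theory Num.Theory.

(** A complete graph has no cutset. Otherwise the ratio of [S] is one of the terms of the minimum,
    and its denominator is positive. *)
Lemma tough_cutset (T : finType) (e : rel T) (S : {set T}) :
  symmetric e -> tough e 7 -> cutset e S -> 7 * num_components e S <= #|S|.
Proof.
move=> e_sym e_tough cS; have [c_comp|c_ncomp] := boolP (complete e).
  move: cS; rewrite /cutset /num_components ltnNge => /negP[].
  apply/card_le1_eqP => _ _ /imsetP[x xS ->] /imsetP[y yS ->].
  apply/setP=> z; rewrite !inE; congr (_ && _).
  apply: same_connect; first exact: del_connect_sym.
  have [->|xy] := eqVneq y x; first exact: connect0.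
  apply: connect1; rewrite !inE in xS yS; apply/and3P; split=> //.
  by move: c_comp => /forallP/(_ y)/forallP/(_ x)/implyP; apply.
move: e_tough; rewrite /tough /toughness (negbTE c_ncomp) => e_tough.
have c_gt0 : (0 < (num_components e S)%:R :> rat)%R by rewrite ltr0n; apply: ltnW.
have : (7%:R%:E <= (#|S|%:R / (num_components e S)%:R : rat)%R%:E)%E.
  apply: le_trans e_tough _; exact: bigmin_le_cond.
by rewrite lee_fin ler_pdivlMr // -natrM ler_nat.
Qed.

Lemma tough_hamiltonian (T : finType) (e : rel T) (X : {set T}) :
  symmetric e -> irreflexive e -> tough e 7 ->
  is_free (disjoint_union (path_graph 4) (path_graph 1)) e ->
  cutset e X -> hamiltonian e.
Proof.
move=> e_sym e_irr e_tough e_free X_cut.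
have tcut S := @tough_cutset T e S e_sym e_tough.
have X_ge : 14 <= #|X|.
  by apply: leq_trans (tcut X X_cut); rewrite (leq_mul2l 7 2).
have T_ge : 14 <= #|T| := leq_trans X_ge (max_card _).
have [x [y xy]] : exists x y, e x y.
  have [/existsP[x /existsP[y xy]]|noe] := boolP [exists x, exists y, e x y].
    by exists x, y.
  have [x [y [_ _ xy]]] : exists x y, [/\ x \in T, y \in T & x != y].
    by apply/card_gt1P; apply: leq_trans T_ge.
  (* Without edges, the empty set would already be a cutset. *)
  have : 14 <= #|set0 : {set T}|; last by rewrite cards0.
  apply: (@not_connected_out T e e_sym tcut set0 x y); rewrite ?inE //.
  apply/negP => cxy; have [u [v [_ _ /and3P[_ _ uv] _]]] :=
    connect_exit (P := pred1 x) cxy (eqxx x) (etrans (congr1 negb (eq_sym y x)) xy).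
  by case/negP: noe; apply/existsP; exists u; apply/existsP; exists v.
(* [ucycle] accepts an edge as a closed walk of length two, so a longest cycle exists and is
   nonempty. *)
have cyc2 : ucycle e [:: x; y].
  by rewrite /ucycle /= inE xy e_sym xy !andbT; apply: contraTneq xy => ->; rewrite e_irr.
pose P k := [exists c : k.-tuple T, ucycleb e c].
have exP : exists k, P k by exists 2; apply/existsP; exists [tuple x; y].
have ubP k : P k -> k <= #|T|.
  case/existsP=> c /andP[_ cU]; rewrite -(size_tuple c) -(card_uniqP cU).
  exact: max_card.
have [n /existsP[c c_cyc] n_max] := ex_maxnP exP ubP.
have longest d : ucycle e d -> size d <= size c.
  move=> d_cyc; rewrite size_tuple; apply: n_max; apply/existsP.
  by exists (in_tuple d).
have c2 : 1 < size c := longest _ cyc2.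
have all_c z : z \in (c : seq T).
  apply/negPn/negP => zc.
  by apply: (longest_cycle_spanning e_sym e_irr e_free tcut c_cyc longest _ zc);
    rewrite -size_eq0; case: (size c) c2.
exists c; split=> //.
have /andP[_ cU] := c_cyc.
have <- : #|T| = size c by rewrite -(card_uniqP cU); apply: eq_card => z; rewrite all_c.
exact: leq_trans T_ge.
Qed.

Local Open Scope ring_scope.

Theorem lemma3p1 (T : finType) (e : rel T)
    (e_sym : symmetric e) (e_irr : irreflexive e)
    (e_tough : tough e 7)
    (e_free : is_free (disjoint_union (path_graph 4) (path_graph 1)) e)
    (a : rat) (a_def : a = #|T|%:R / 8)
    (X : {set T}) (X_cut : cutset e X)
    (D : {set T}) (D_comp : D \in components e X)
    (D_large :
      (#|D|%:R > 2 * a - 2 /\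
         \sum_(D' in components e X | D' != D) #|D'|%:R > a - 1)
      \/
      (#|D|%:R > a - 1 /\
         \sum_(D' in components e X | D' != D) #|D'|%:R > 2 * a - 2)) :
  hamiltonian e.
Proof. exact: tough_hamiltonian e_sym e_irr e_tough e_free X_cut. Qed.
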